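(* Let $\alpha\ge0$; let $F:H\to H$, $H=L^2((0,1);\mathbb{C})$, satisfy $\|F(v)-F(w)\|\le L_F\|v-w\|$ for all $v,w\in H$ with a constant $L_F>0$, $F(0)=0$, and $\mathrm{Im}\langle\overline v,F(v)\rangle=0$ for all $v\in H$; and let $Q$ be a nonnegative symmetric operator on $H$ with $Q^{\frac12}\in\mathcal{L}(H)$ (i.e. $Q^{\frac12}$ is a bounded linear operator on $H$). Let $T>0$, $N,J\ge1$ integers, $\delta T=T/N$, $\delta t=\delta T/J$, $T_n=n\,\delta T$, $t_{n,j}=T_n+j\,\delta t$. Let $\{u_n^{(k)}\}_{0\le n\le N,\,k\in\mathbb{N}}$ be the solution of the fully discrete parareal scheme $$\begin{aligned}&u_{n+1}^{(0)}=\mathcal{G}_I(T_{n+1},T_n,u_n^{(0)}),\\ &\hat u_{n,j}^{(k-1)}=\mathcal{F}_I(t_{n,j},t_{n,j-1},\hat u_{n,j-1}^{(k-1)}),\quad \hat u_{n,0}^{(k-1)}=u_n^{(k-1)},\quad j=1,\dots,J,\ k\ge1,\\ &u_{n+1}^{(k)}=\mathcal{G}_I(T_{n+1},T_n,u_n^{(k)})+\hat u_{n,J}^{(k-1)}-\mathcal{G}_I(T_{n+1},T_n,u_n^{(k-1)}),\quad k\ge1,\end{aligned}$$ for $n=0,\dots,N-1$, with $u_0^{(k)}=u_0$ for all $k\in\mathbb{N}$. Let $v_{n,j}$ be the serial fine solution: $v_{0,0}=u_0$, $v_{n,j}=\mathcal{F}_I(t_{n,j},t_{n,j-1},v_{n,j-1})$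 for $j=1,\dots,J$, and $v_{n+1,0}:=v_{n,J}$. Then for any $k\in\mathbb{N}$ it holds, with a positive constant $C$, $$\sup_{0\le n\le N}\big\|u_n^{(k)}-v_{n,0}\big\|_{L^2(\Omega;H)}\le\big(e^{-\alpha\delta T}\big)^k\frac{(CT)^k}{k!}\Big(e^{(L_F-\alpha)T}\vee1\Big)\sup_{0\le n\le N}\big\|u_n^{(0)}-v_{n,0}\big\|_{L^2(\Omega;H)}.$$ In addition, if $\alpha>0$ and $\delta T\in[\delta T_*,1)$, where $\delta T_*=\delta T_*(\alpha)\in(0,1)$ satisfies $\delta T_*^{-1}\ln\delta T_*^{-1}=\alpha$, then the error shows order $k$ with respect to $\delta T$: $$\sup_{0\le n\le N}\big\|u_n^{(k)}-v_{n,0}\big\|_{L^2(\Omega;H)}\le(\delta T)^k\frac{(CT)^k}{k!}\Big(e^{(L_F-\alpha)T}\vee1\Big)\sup_{0\le n\le N}\big\|u_n^{(0)}-v_{n,0}\big\|_{L^2(\Omega;H)} .$$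
   Context: $H=L^2((0,1);\mathbb{C})$ with norm $\|\cdot\|$, $\langle v_1,v_2\rangle:=\int_0^1v_1(x)v_2(x)\,dx$ (no complex conjugation), $\mathbf{i}=\sqrt{-1}$, $a\vee b=\max\{a,b\}$, $\mathbb{N}$ includes $0$, and $\Delta$ is the Dirichlet Laplacian on $(0,1)$ with eigenfunctions $e_m(x)=\sqrt2\sin(m\pi x)$, $m\ge1$. $W(t)=\sum_{m\ge1}e_m\beta_m(t)$ is a cylindrical Wiener process on a complete filtered probability space $(\Omega,\mathcal{B},\mathbb{P},\{\mathcal{B}_t\}_{t\ge0})$, where the $\beta_m$ are mutually independent, identically distributed $\mathbb{C}$-valued Brownian motions. $u_0$ is the ($H$-valued) initial value. The scheme approximates $du=(\mathbf{i}\Delta u-\alpha u+\mathbf{i}F(u))\,dt+Q^{\frac12}dW$, $u(0)=u_0$, with homogeneous Dirichlet boundary conditions. $S(t):=e^{-t\Lambda}$ with $\Lambda:=-\mathbf{i}\Delta+\alpha$. The coarse and fine propagators are, for $v\in H$, $$\mathcal{G}_I(T_{n+1},T_n,v):=S(\delta T)v+\mathbf{i}S(\delta T)F(v)\,\delta T+S(\delta T)Q^{\frac12}\big(W(T_{n+1})-W(T_n)\big),$$ $$\mathcal{F}_I(t_{n,j},t_{n,j-1},v):=S(\delta t)v+\mathbf{i}S(\delta t)F(v)\,\delta t+S(\delta t)Q^{\frac12}\big(W(t_{n,j})-W(t_{n,j-1})\big).$$ *)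

(* Defs.v *)
From HB Require Import structures.
From mathcomp Require Import all_boot all_order all_algebra.
From mathcomp Require Import generic_quotient ring_quotient.
From mathcomp Require Import complex.
From mathcomp Require Import all_classical all_reals all_analysis.
From mathcomp Require Import measurable_realfun.

Set Implicit Arguments.
Unset Strict Implicit.
Unset Printing Implicit Defensive.

Import Order.TTheory GRing.Theory Num.Theory.
Import numFieldNormedType.Exports.

Local Open Scope classical_set_scope.
Local Open Scope complex_scope.
Local Open Scope ring_scope.
Local Open Scope quotient_scope.

Section L2space.
Variable R : realType.

(* Functions are total on [R]; only their values on (0,1) matter, because the
   reference measure does not charge the complement of (0,1). *)
Definition mu01 : {measure set (measurableTypeR R) -> \bar R} :=
  mrestr (@lebesgue_measure R) (measurable_itv `]0, 1[%R).

Definition L2pred : {pred R -> R[i]} :=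
  [pred f : R -> R[i] | ((fun x => complex.Re (f x)) \in Lfun mu01 2%:E) &&
            ((fun x => complex.Im (f x)) \in Lfun mu01 2%:E)].

Lemma L2pred_submod : submod_closed L2pred.
Proof.
have N : @submod_closed R (R -> R) (Lfun mu01 2%:E).
  exact: (@Lfun_submod_closed _ _ _ mu01 2%:E (lee1n 2)).
have [N0 ND] := N.
split; first by apply/andP; split; exact: N0.
move=> a f g /andP[/= fr fi] /andP[/= gr gi]; apply/andP; split => /=.
  have -> : (fun x => complex.Re ((a *: f + g) x)) =
      (complex.Re a) *: (fun x => complex.Re (f x)) +
      ((- complex.Im a) *: (fun x => complex.Im (f x)) +
       (fun x => complex.Re (g x))).
    apply/funext => x; rewrite !fctE /=.
    case: (f x) (g x) => u v [u' v'] /=.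
    case: a => a b /=.
    by rewrite addrA scaleNr.
  by apply: (ND) => //; exact: ND.
have -> : (fun x => complex.Im ((a *: f + g) x)) =
    (complex.Re a) *: (fun x => complex.Im (f x)) +
    ((complex.Im a) *: (fun x => complex.Re (f x)) + (fun x => complex.Im (g x))).
  apply/funext => x; rewrite !fctE /=.
  case: (f x) (g x) => u v [u' v'] /=.
  case: a => a b /=.
  by rewrite addrA.
by apply: (ND) => //; exact: ND.
Qed.

HB.instance Definition _ :=
  GRing.isSubmodClosed.Build R[i] (R -> R[i]) L2pred L2pred_submod.

Record L2fun := MkL2fun { L2fun_val :> R -> R[i]; _ : L2fun_val \in L2pred }.
HB.instance Definition _ := [isSub for L2fun_val].
HB.instance Definition _ := [Choice of L2fun by <:].
HB.instance Definition _ := [SubChoice_isSubLmodule of L2fun by <:].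

Definition L2null : {pred L2fun} :=
  [pred f : L2fun | `[< {ae mu01, forall x, f x = 0} >] ].

Lemma L2null_submod : submod_closed L2null.
Proof.
split; first by apply/asboolP; apply: aeW => x.
move=> a f g /asboolP f0 /asboolP g0; apply/asboolP.
have h : Filter (almost_everywhere mu01) by typeclasses eauto.
move: f0 g0; apply: (@filterS2 _ _ h) => x fx gx.
by rewrite /= !fctE fx gx scaler0 addr0.
Qed.

HB.instance Definition _ :=
  GRing.isSubmodClosed.Build R[i] L2fun L2null L2null_submod.

Definition H := Quotient.quot L2null.
HB.instance Definition _ := GRing.Zmodule.on H.
HB.instance Definition _ := Choice.on H.
HB.instance Definition _ := EqQuotient.on H.

Definition Hscale (a : R[i]) (v : H) : H := \pi_H (a *: repr v).

Lemma Hscale_pi a f : Hscale a (\pi_H f) = \pi_H (a *: f).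
Proof.
apply/eqP; rewrite -Quotient.idealrBE -scalerBr rpredZ //.
by rewrite Quotient.idealrBE reprK.
Qed.

Fact HscaleA a b v : Hscale a (Hscale b v) = Hscale (a * b) v.
Proof. by rewrite {2}/Hscale Hscale_pi scalerA. Qed.

Fact Hscale1 : left_id 1 Hscale.
Proof. by move=> v; rewrite /Hscale scale1r reprK. Qed.

Fact HscaleDr : right_distributive Hscale +%R.
Proof.
move=> a; elim/quotW => f; elim/quotW => g.
by rewrite -(raddfD \pi_H) !Hscale_pi scalerDr raddfD.
Qed.

Fact HscaleDl v : {morph Hscale^~ v : a b / a + b}.
Proof. by move=> a b; rewrite /Hscale scalerDl raddfD. Qed.

HB.instance Definition _ := GRing.Zmodule_isLmodule.Build R[i] H
  HscaleA Hscale1 HscaleDr HscaleDl.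


Definition Hfun (v : H) : R -> R[i] := repr v.

Definition e_fun (m : nat) (x : R) : R[i] :=
  (Num.sqrt 2 * sin (m%:R * pi * x))%:C.

Fact e_fun_L2 m : e_fun m \in L2pred.
Proof.
apply/andP; split; last first.
  have [N0 _] := @Lfun_submod_closed _ _ _ mu01 2%:E (lee1n 2).
  exact: N0.
have mf : measurable_fun setT (fun x : R => Num.sqrt 2 * sin (m%:R * pi * x)).
  apply: measurable_funM; first exact: measurable_cst.
  apply: (@measurableT_comp _ _ _ _ _ _ (@sin R)).
    apply: (@continuous_measurable_fun R sin) => x; exact: continuous_sin.
  by apply: measurable_funM; [exact: measurable_cst|exact: measurable_id].
apply/andP; split; first by rewrite inE.
rewrite inE /= /finite_norm unlock; apply: poweR_lty.
apply: (@le_lt_trans _ _ (\int[mu01]_x (Num.sqrt 2 `^ 2)%:E)%E).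
  apply: ge0_le_integral => //.
  - by move=> x _; exact: poweR_ge0.
  - apply/measurable_EFinP.
    apply: (@measurableT_comp _ _ _ _ _ _ (@powR R ^~ 2)).
      exact: measurable_powR.
    exact: measurableT_comp.
  - move=> x _ /=. rewrite lee_fin ge0_ler_powR ?nnegrE ?sqrtr_ge0 //.
    by rewrite normrM ger0_norm ?sqrtr_ge0 // ler_piMr ?sqrtr_ge0 // sin_max.
rewrite integral_cst //; apply: lte_mul_pinfty => //.
apply: (@le_lt_trans _ _ (@lebesgue_measure R `]0, 1[)).
  by apply: le_measure; rewrite ?inE //; exact: measurableI.
by rewrite lebesgue_measure_itv /= lte_fin ltr01 -EFinB ltry.
Qed.

Definition e_ (m : nat) : H := \pi_H (MkL2fun (e_fun_L2 m)).

Definition cintegral (f : R -> R[i]) : R[i] :=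
  Complex (\int[mu01]_x complex.Re (f x)) (\int[mu01]_x complex.Im (f x)).

(* Bilinear, not sesquilinear. *)
Definition pairing (f g : R -> R[i]) : R[i] := cintegral (fun x => f x * g x).

Definition hnorm (v : H) : R :=
  fine ('N[mu01]_2%:E[(fun x => (ComplexField.Normc.normc (Hfun v x))%:E)])%E.

Definition hconj (v : H) : R -> R[i] := fun x => conjc (Hfun v x).

Definition hcvg (w : nat -> H) (v : H) : Prop :=
  (fun M => hnorm (w M - v)) @ \oo --> (0 : R).

End L2space.

Section Operators.
Variable R : realType.
Implicit Types (v w : H R).

Definition bounded_op (A : H R -> H R) : Prop :=
  exists c : R, forall v, hnorm (A v) <= c * hnorm v.

Definition nonneg_symmetric (A : H R -> H R) : Prop :=
  (forall v w, pairing (hconj (A v)) (Hfun w) = pairing (hconj v) (Hfun (A w)))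
  /\ (forall v, 0 <= pairing (hconj v) (Hfun (A v))).

Definition cexp (z : R[i]) : R[i] :=
  (expR (complex.Re z))%:C * (cos (complex.Im z) +i* sin (complex.Im z)).

Definition laplace_eig (m : nat) : R := - (m%:R * pi) ^+ 2.

Definition Lambda_eig (alpha : R) (m : nat) : R[i] :=
  - ((0 +i* 1) * (laplace_eig m)%:C) + alpha%:C.

(* [S t] is the operator exp (- t Lambda) given by the spectral decomposition
   of Lambda = - i Delta + alpha in the eigenbasis of the Dirichlet Laplacian. *)
Definition is_exp_semigroup (alpha : R) (S : R -> H R -> H R) : Prop :=
  forall t v, 0 <= t ->
    hcvg (fun M => \sum_(1 <= m < M.+1)
            (cexp (- t%:C * Lambda_eig alpha m) *
             pairing (Hfun v) (Hfun (e_ R m))) *: e_ R m)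
         (S t v).

End Operators.

Section Probability.
Context (R : realType) (d : measure_display) (Omega : measurableType d).
Variable P : probability Omega R.
Implicit Types (G : set (set Omega)) (Filt : R -> set (set Omega)).

Definition filtration Filt : Prop :=
  [/\ forall t, 0 <= t -> sigma_algebra setT (Filt t),
      forall t, 0 <= t -> Filt t `<=` measurable &
      forall s t, 0 <= s -> s <= t -> Filt s `<=` Filt t].

Definition complete_filtered_space Filt : Prop :=
  [/\ filtration Filt, measure_is_complete P &
      forall A : set Omega, P.-negligible A -> Filt 0 A].

Definition measurable_wrt G (X : Omega -> R) : Prop :=
  forall A : set (measurableTypeR R), measurable A -> G (X @^-1` A).

(* Strong (Bochner) measurability; [H] being separable, this is the same as
   Borel measurability. *)
Definition H_simple G (X : Omega -> H R) : Prop :=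
  finite_set (range X) /\ forall v, G (X @^-1` [set v]).

Definition H_measurable_wrt G (X : Omega -> H R) : Prop :=
  exists Xn : nat -> Omega -> H R,
    (forall n, H_simple G (Xn n)) /\
    (forall w, hcvg (fun n => Xn n w) (X w)).

Definition H_random_variable (X : Omega -> H R) : Prop :=
  H_measurable_wrt measurable X.

Definition L2_Omega_H_norm (X : Omega -> H R) : \bar R :=
  ('N[P]_2%:E[(fun w => (hnorm (X w))%:E)])%E.

Definition process_sigma (X : R -> Omega -> R) : set (set Omega) :=
  <<s \bigcup_(t in [set t : R | 0 <= t])
        preimage_set_system setT (X t) (@measurable _ (measurableTypeR R)) >>.

Definition Re_process (b : R -> Omega -> R[i]) t w := complex.Re (b t w).
Definition Im_process (b : R -> Omega -> R[i]) t w := complex.Im (b t w).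

Definition cprocess_sigma (b : R -> Omega -> R[i]) : set (set Omega) :=
  <<s process_sigma (Re_process b) `|` process_sigma (Im_process b) >>.

Definition independent_systems G1 G2 : Prop :=
  forall A B, G1 A -> G2 B -> (P (A `&` B) = P A * P B)%E.

Definition mutually_independent_systems (I : eqType) (D : set I)
    (G : I -> set (set Omega)) : Prop :=
  forall (s : seq I) (A : I -> set Omega),
    uniq s -> (forall i, i \in s -> D i /\ G i (A i)) ->
    (P (\big[setI/setT]_(i <- s) A i) = \prod_(i <- s) P (A i))%E.

Record brownian Filt (sigma : R) (B : R -> Omega -> R) : Prop := Brownian {
  brownian_adapted : forall t, 0 <= t -> measurable_wrt (Filt t) (B t);
  brownian0 : {ae P, forall w, B 0 w = 0};
  brownian_continuous :
    {ae P, forall w, {within `[0, +oo[, continuous (fun t => B t w)}};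
  brownian_law : forall s t (A : set (measurableTypeR R)),
    0 <= s -> s < t -> measurable A ->
    P ((fun w => B t w - B s w) @^-1` A) =
      normal_prob 0 (sigma * Num.sqrt (t - s)) A;
  brownian_indep : forall s t, 0 <= s -> s < t ->
    independent_systems (Filt s)
      (preimage_set_system setT (fun w => B t w - B s w)
         (@measurable _ (measurableTypeR R))) }.

Definition complex_brownian Filt (sigma : R) (b : R -> Omega -> R[i]) : Prop :=
  [/\ brownian Filt sigma (Re_process b),
      brownian Filt sigma (Im_process b) &
      independent_systems (process_sigma (Re_process b))
                          (process_sigma (Im_process b))].

(* The coordinates of a cylindrical Wiener process W = sum_m e_m beta_m.  The
   common [sigma] makes the beta_m identically distributed and leaves the
   normalisation of a C-valued Brownian motion free. *)
Definition wiener_coordinates Filt (sigma : R)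
    (beta : nat -> R -> Omega -> R[i]) : Prop :=
  (forall m, (0 < m)%N -> complex_brownian Filt sigma (beta m)) /\
  mutually_independent_systems [set m : nat | (0 < m)%N]
    (fun m => cprocess_sigma (beta m)).

(* [QW t] is the H-valued random variable Q^(1/2) W(t), where
   W(t) = sum_m e_m beta_m(t) does not itself converge in [H]: the action of
   Q^(1/2) W(t) on any h is the mean-square limit of
   sum_m beta_m(t) <Q^(1/2) e_m, h>. *)
Definition is_noise (Qhalf : H R -> H R) (beta : nat -> R -> Omega -> R[i])
    (QW : R -> Omega -> H R) : Prop :=
  forall t, 0 <= t -> H_random_variable (QW t) /\
    forall h : H R,
      (fun M => 'N[P]_2%:E[(fun w => (ComplexField.Normc.normc
         (\sum_(1 <= m < M.+1)
            beta m t w * pairing (Hfun (Qhalf (e_ R m))) (Hfun h)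
          - pairing (Hfun (QW t w)) (Hfun h)))%:E)])%E @ \oo --> 0%E.

(* One exponential Euler step of size [h] over [s, t]:
   S(h) v + i S(h) F(v) h + S(h) Q^(1/2) (W(t) - W(s)). *)
Definition propagator (S : R -> H R -> H R) (F : H R -> H R)
    (QW : R -> Omega -> H R) (h t s : R) (v : Omega -> H R) (w : Omega) : H R :=
  S h (v w) + (0 +i* h) *: S h (F (v w)) + S h (QW t w - QW s w).

End Probability.

(* Main.v *)
Require Import Defs.
From HB Require Import structures.
From mathcomp Require Import all_boot all_order all_algebra.
From mathcomp Require Import generic_quotient ring_quotient.
From mathcomp Require Import complex.
From mathcomp Require Import all_classical all_reals all_analysis.
From mathcomp Require Import measurable_realfun.
From mathcomp Require Import ring lra.

Set Implicit Arguments.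
Unset Strict Implicit.
Unset Printing Implicit Defensive.

Import Order.TTheory GRing.Theory Num.Theory.
Import numFieldNormedType.Exports.

Local Open Scope classical_set_scope.
Local Open Scope ring_scope.

(* The noise is additive, so it cancels in the difference of two numerical solutions and the
   estimate can be made path by path.  The functions e_m are orthonormal, so Bessel's inequality
   gives [|S t v| <= exp (- alpha t) |v|] (completeness of the basis is not needed), and comparing
   coefficients gives [S s (S t v) = S (s + t) v].  Hence G is Lipschitz with constant
   [a = exp (- alpha dT) (1 + LF dT)], and the linear parts cancel in the difference between J
   fine steps and one coarse step, which is Lipschitz with constant [b = exp (- alpha dT) C dT],
   where [C = LF (exp (LF T) + 1)].  The errors therefore satisfy
   [e (k+1) (n+1) <= a e (k+1) n + b e k n], first pointwise and then, by Minkowski, in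
   L2(Omega; H).  Pascal's rule yields
   [e k n <= b^k binom(n, k) (max a 1)^n sup e 0], and [binom(n, k) <= N^k / k!]. *)

(** * Almost everywhere statements *)

Section AlmostEverywhere.
Context d (T : measurableType d) (R : realType) (m : {measure set T -> \bar R}).

Lemma aeS (P Q : T -> Prop) : (forall x, P x -> Q x) ->
  {ae m, forall x, P x} -> {ae m, forall x, Q x}.
Proof. by move=> PQ; apply: filterS. Qed.

Lemma aeS2 (P Q S : T -> Prop) : (forall x, P x -> Q x -> S x) ->
  {ae m, forall x, P x} -> {ae m, forall x, Q x} -> {ae m, forall x, S x}.
Proof. by move=> PQ; apply: filterS2. Qed.

End AlmostEverywhere.

(** * The real inner product *)

Section HilbertSpace.
Local Open Scope quotient_scope.
Variable R : realType.
Implicit Types (f g : R -> R[i]) (v w : H R) (a b : R[i]) (r : R).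

Local Notation mu := (mu01 R).
Local Notation Re := complex.Re.
Local Notation Im := complex.Im.
Local Notation "''i'" := (Complex 0 1 : R[i]) : ring_scope.

(** The real part of the Hermitian product of $L^2(0,1)$: [H] is handled as a real Hilbert space on
    which multiplication by ['i] is a skew isometry. *)
Definition rdot f g : R :=
  \int[mu]_x (Re (f x) * Re (g x) + Im (f x) * Im (g x)).

Definition rip v w : R := rdot (Hfun v) (Hfun w).

Lemma Hfun_L2 v : Hfun v \in @L2pred R.
Proof. exact: valP (repr v). Qed.

Lemma L2_mul_integrable (h k : R -> R) : h \in Lfun mu 2%:E ->
  k \in Lfun mu 2%:E -> mu.-integrable setT (EFin \o (fun x => h x * k x)).
Proof. by move=> hh hk; apply/Lfun1_integrable; exact: Lfun2_mul_Lfun1. Qed.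

Lemma L2_Re f : f \in @L2pred R -> (fun x => Re (f x)) \in Lfun mu 2%:E.
Proof. by case/andP. Qed.

Lemma L2_Im f : f \in @L2pred R -> (fun x => Im (f x)) \in Lfun mu 2%:E.
Proof. by case/andP. Qed.

Lemma rdot_integrable f g : f \in @L2pred R -> g \in @L2pred R ->
  mu.-integrable setT
    (EFin \o (fun x => Re (f x) * Re (g x) + Im (f x) * Im (g x))).
Proof.
move=> hf hg.
have := integrableD measurableT
  (L2_mul_integrable (L2_Re hf) (L2_Re hg))
  (L2_mul_integrable (L2_Im hf) (L2_Im hg)).
by apply: eq_integrable => // x _; rewrite /= EFinD.
Qed.

Lemma ae_eq_Rintegral (h k : R -> R) : mu.-integrable setT (EFin \o h) ->
  mu.-integrable setT (EFin \o k) -> {ae mu, forall x, h x = k x} ->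
  \int[mu]_x h x = \int[mu]_x k x.
Proof.
move=> /integrableP[mh _] /integrableP[mk _] hk; congr fine.
by apply: ae_eq_integral => //; apply: (@aeS _ _ _ mu _ _ _ hk) => x /= -> _.
Qed.

Lemma rdotC f g : rdot f g = rdot g f.
Proof.
by apply: eq_Rintegral => x _; rewrite ![Re (f x) * _]mulrC ![Im (f x) * _]mulrC.
Qed.

Lemma rdot_ae f f' g : f \in @L2pred R -> f' \in @L2pred R ->
  g \in @L2pred R -> {ae mu, forall x, f x = f' x} -> rdot f g = rdot f' g.
Proof.
move=> hf hf' hg ff'; apply: ae_eq_Rintegral; try exact: rdot_integrable.
by apply: (@aeS _ _ _ mu _ _ _ ff') => x /= ->.
Qed.

(** [Hfun] picks an arbitrary representative of a class, so pointwise identities for it hold only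
    outside a null set; [rdot_ae] carries them over to inner products. *)
Lemma Hfun_pi (f : L2fun R) : {ae mu, forall x, Hfun (\pi_(H R) f) x = f x}.
Proof.
have : (\pi_(H R) (repr (\pi_(H R) f)) == \pi_(H R) f)%qT by rewrite reprK.
rewrite -Quotient.idealrBE => /asboolP; apply: (@aeS _ _ _ mu) => x.
by rewrite /= !fctE => /eqP; rewrite subr_eq0 => /eqP.
Qed.

Lemma HfunD v w : {ae mu, forall x, Hfun (v + w) x = Hfun v x + Hfun w x}.
Proof.
have -> : v + w = \pi_(H R) (repr v + repr w) by rewrite raddfD /= !reprK.
exact: Hfun_pi.
Qed.

Lemma HfunZ a v : {ae mu, forall x, Hfun (a *: v) x = a * Hfun v x}.
Proof. exact: (Hfun_pi (a *: repr v)). Qed.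

Lemma ripC v w : rip v w = rip w v. Proof. exact: rdotC. Qed.

Lemma ripDl v w z : rip (v + w) z = rip v z + rip w z.
Proof.
rewrite /rip /rdot -RintegralD//; try exact/rdot_integrable/Hfun_L2/Hfun_L2.
apply: ae_eq_Rintegral.
- exact/rdot_integrable/Hfun_L2/Hfun_L2.
- have := integrableD measurableT
    (rdot_integrable (Hfun_L2 v) (Hfun_L2 z))
    (rdot_integrable (Hfun_L2 w) (Hfun_L2 z)).
  by apply: eq_integrable.
apply: (@aeS _ _ _ mu _ _ _ (HfunD v w)) => x /= ->.
case: (Hfun v x) (Hfun w x) => p q [p' q'] /=; ring.
Qed.

Lemma L2predZ a v : (fun x => a * Hfun v x) \in @L2pred R.
Proof. exact: (valP (a *: repr v)). Qed.

Lemma ripZE a v w : rip (a *: v) w = rdot (fun x => a * Hfun v x) (Hfun w).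
Proof. exact: rdot_ae (Hfun_L2 _) (L2predZ a v) (Hfun_L2 w) (HfunZ a v). Qed.

Lemma ripZl a v w : rip (a *: v) w = Re a * rip v w + Im a * rip ('i *: v) w.
Proof.
have iz b z := rdot_integrable (L2predZ b z) (Hfun_L2 w).
rewrite !ripZE /rip /rdot -!RintegralZl//; last exact/rdot_integrable/Hfun_L2/Hfun_L2.
rewrite -RintegralD//.
- by apply: eq_Rintegral => x _; case: a (Hfun v x) => p q [p' q'] /=; ring.
- have := integrableZl measurableT (Re a) (rdot_integrable (Hfun_L2 v) (Hfun_L2 w)).
  by apply: eq_integrable.
- have := integrableZl measurableT (Im a) (iz 'i v).
  by apply: eq_integrable.
Qed.

Lemma rip_ge0 v : 0 <= rip v v.
Proof. by apply: Rintegral_ge0 => x _; rewrite -!expr2 addr_ge0 ?sqr_ge0. Qed.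

Lemma rip_eq0 v : rip v v = 0 -> v = 0.
Proof.
have h0 x : 0 <= Re (Hfun v x) * Re (Hfun v x) + Im (Hfun v x) * Im (Hfun v x).
  by rewrite -!expr2 addr_ge0 ?sqr_ge0.
have hi := rdot_integrable (Hfun_L2 v) (Hfun_L2 v).
have [mh _] := integrableP _ _ _ hi.
rewrite /rip /rdot /Rintegral => /eqP; rewrite fine_eq0; last exact: integrable_fin_num.
move=> /eqP h.
set q : R -> R := (fun x => _) in hi mh h0 h.
(* A nonnegative integrand with zero integral vanishes almost everywhere, which puts the
   representative in the null submodule. *)
have : (\int[mu]_x `|(EFin \o q) x| = 0)%E.
  by rewrite -[RHS]h; apply: eq_integral => x _; rewrite /= ger0_norm //; exact: h0.
move=> /(ae_eq_integral_abs _ measurableT mh) hae.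
suff : repr v - 0 \in @L2null R.
  by rewrite Quotient.idealrBE => /eqP; rewrite reprK => ->; rewrite raddf0.
apply/asboolP; apply: (@aeS _ _ _ mu _ _ _ hae) => x /= /(_ I) [].
rewrite subr0.
rewrite /q /Hfun; case: (repr v x) => p p' /= /eqP.
rewrite paddr_eq0 -?expr2 ?sqr_ge0 // !sqrf_eq0 => /andP[/eqP -> /eqP ->].
by [].
Qed.

Lemma hnormE v : hnorm v = Num.sqrt (rip v v).
Proof.
have hi := integrable_fin_num measurableT (rdot_integrable (Hfun_L2 v) (Hfun_L2 v)).
have E : (\int[mu]_x `|(Normc.normc (Hfun v x))%:E| `^ 2 = (rip v v)%:E)%E.
  rewrite /rip /rdot /Rintegral fineK //; apply: eq_integral => x _.
  case: (Hfun v x) => p q /=.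
  by rewrite powR_mulrn // real_normK ?num_real // sqr_sqrtr -?expr2 // addr_ge0 ?sqr_ge0.
by rewrite /hnorm unlock E poweR_EFin /= powR12_sqrt // rip_ge0.
Qed.

Lemma hnorm_ge0 v : 0 <= hnorm v. Proof. by rewrite hnormE sqrtr_ge0. Qed.

Lemma hnorm_sqr v : hnorm v ^+ 2 = rip v v.
Proof. by rewrite hnormE sqr_sqrtr ?rip_ge0. Qed.

Lemma hnorm_eq0 v : hnorm v = 0 -> v = 0.
Proof. by move=> h; apply: rip_eq0; rewrite -hnorm_sqr h expr0n. Qed.

Lemma rip0l w : rip 0 w = 0.
Proof. by have := ripDl 0 0 w; rewrite addr0 => h; lra. Qed.

Lemma hnorm0 : hnorm (0 : H R) = 0.
Proof. by rewrite hnormE rip0l sqrtr0. Qed.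

Lemma ripDr v w z : rip z (v + w) = rip z v + rip z w.
Proof. by rewrite ripC ripDl ![rip _ z]ripC. Qed.

Lemma ripZr a v w : rip w (a *: v) = Re a * rip w v + Im a * rip w ('i *: v).
Proof. by rewrite ripC ripZl ![rip _ w]ripC. Qed.

Lemma ripNl v w : rip (- v) w = - rip v w.
Proof. by apply/eqP; rewrite -addr_eq0 -ripDl addNr rip0l. Qed.

Lemma ripNr v w : rip v (- w) = - rip v w.
Proof. by rewrite ripC ripNl ripC. Qed.

Lemma rip_i v w : rip ('i *: v) w = - rip v ('i *: w).
Proof.
have iv := rdot_integrable (L2predZ 'i v) (Hfun_L2 w).
have iw := rdot_integrable (L2predZ 'i w) (Hfun_L2 v).
apply/eqP; rewrite -addr_eq0 [rip v _]ripC !ripZE /rdot -RintegralD //.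
apply/eqP; transitivity (\int[mu]_(x in setT) (0 : R)); last first.
  by rewrite /Rintegral integral0.
apply: eq_Rintegral => x _; case: (Hfun v x) (Hfun w x) => p q [p' q'] /=. ring.
Qed.

Lemma rip_ii v w : rip ('i *: v) ('i *: w) = rip v w.
Proof.
rewrite rip_i scalerA (_ : 'i * 'i = -1); last first.
  by apply/eqP; rewrite eq_complex /=; apply/andP; split; apply/eqP; ring.
by rewrite scaleN1r ripC ripNl opprK ripC.
Qed.

Lemma rip_iv v : rip ('i *: v) v = 0.
Proof. by have := rip_i v v; rewrite [rip v _]ripC => h; lra. Qed.

(** The cross terms carry [rip ('i *: v) v], which is 0, and ['i] preserves [rip]. *)
Lemma ripZ a v : rip (a *: v) (a *: v) = Normc.normc a ^+ 2 * rip v v.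
Proof.
rewrite ripZl [rip v (a *: v)]ripZr [rip ('i *: v) (a *: v)]ripZr.
rewrite rip_ii [rip v ('i *: _)]ripC rip_iv.
case: a => p q /=; rewrite sqr_sqrtr ?addr_ge0 ?sqr_ge0 //; ring.
Qed.

Lemma hnormZ a v : hnorm (a *: v) = Normc.normc a * hnorm v.
Proof.
have n0 : 0 <= Normc.normc a by case: a => p q; exact: sqrtr_ge0.
by rewrite !hnormE ripZ sqrtrM ?sqr_ge0 // sqrtr_sqr ger0_norm.
Qed.

Lemma hnormN v : hnorm (- v) = hnorm v.
Proof. by rewrite !hnormE ripNl ripC ripNl opprK. Qed.

(* Expand [0 <= | |w| v - |v| w |^2]. *)
Lemma rip_le v w : rip v w <= hnorm v * hnorm w.
Proof.
have [v0|v0] := eqVneq (hnorm v) 0.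
  by rewrite v0 mul0r (hnorm_eq0 v0) rip0l.
have [w0|w0] := eqVneq (hnorm w) 0.
  by rewrite w0 mulr0 (hnorm_eq0 w0) ripC rip0l.
have hv : 0 < hnorm v by rewrite lt_def v0 hnorm_ge0.
have hw : 0 < hnorm w by rewrite lt_def w0 hnorm_ge0.
pose r u := Complex (hnorm u) 0 : R[i].
have rl u y z : rip (r u *: y) z = hnorm u * rip y z by rewrite ripZl mul0r addr0.
have rr u y z : rip y (r u *: z) = hnorm u * rip y z by rewrite ripC rl ripC.
have := rip_ge0 (r w *: v - r v *: w).
rewrite !(ripDl, ripDr, ripNl, ripNr, rl, rr) [rip w v]ripC -!hnorm_sqr.
set x := hnorm v in hv *; set y := hnorm w in hw *; set c := rip v w => h.
(* The expansion [h] amounts to $0\le 2xy(xy-c)$, to be divided by $xy$. *)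
have xy : 0 < x * y by rewrite mulr_gt0.
rewrite -(ler_pM2l xy); lra.
Qed.

Lemma hnormD v w : hnorm (v + w) <= hnorm v + hnorm w.
Proof.
rewrite -(@ler_pXn2r _ 2) ?nnegrE ?addr_ge0 ?hnorm_ge0 //.
rewrite hnorm_sqr ripDl !ripDr [rip w v]ripC sqrrD !hnorm_sqr.
have := rip_le v w; lra.
Qed.

End HilbertSpace.

(** * The sine system *)

Section SineBasis.
Variable R : realType.
Implicit Types (v w : H R) (a b : R[i]) (m n : nat).

Local Notation mu := (mu01 R).
Local Notation Re := complex.Re.
Local Notation Im := complex.Im.
Local Notation "''i'" := (Complex 0 1 : R[i]) : ring_scope.

(** The fundamental theorem of calculus for a measure on the whole line: the complement of (0,1) is
    null for [mu01], and the endpoints are null for Lebesgue measure. *)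
Lemma Rintegral_mu01 (f F : R -> R) : continuous f ->
  (forall x : R, is_derive x 1 F (f x)) -> \int[mu]_x f x = F 1 - F 0.
Proof.
move=> cf dF.
have mf : measurable_fun setT (EFin \o f).
  by apply/measurable_EFinP; exact: continuous_measurable_fun.
have mfD (D : set R) : measurable D -> measurable_fun D (EFin \o f).
  by move=> mD; exact: measurable_funS mf.
have m01 : measurable (`]0, 1[ : set (measurableTypeR R)) by exact: measurable_itv.
have E : (\int[mu]_x (f x)%:E = \int[mu]_(x in `]0%R, 1%R[) (f x)%:E)%E.
  rewrite [RHS]integral_mkcond; apply: ae_eq_integral => //.
    by apply/(measurable_restrictT _ m01); exact: mfD.
  exists (~` `]0%R, 1%R[%classic); split; first exact: measurableC.
    by rewrite /= /mu01 /mrestr setICl measure0.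
  move=> x /= nx x01; apply: nx => _; rewrite patchE.
  by case: ifPn => //; rewrite notin_setE.
have F01 : (\int[mu]_x (f x)%:E = (F 1)%:E - (F 0)%:E)%E.
  rewrite E (@eq_measure_integral _ _ _ _ (@lebesgue_measure R)); last first.
    by move=> A mA AD; rewrite /= /mu01 /mrestr setIidl.
  rewrite integral_itv_obnd_cbnd; last exact: mfD.
  rewrite integral_itv_bndo_bndc; last exact: mfD.
  have cF : continuous F.
    by move=> x; apply/differentiable_continuous/derivable1_diffP/(@ex_derive _ _ _ _ _ _ _ (dF x)).
  apply: continuous_FTC2 => //.
  - exact: continuous_subspaceT.
  - split; first by move=> x _; exact: (@ex_derive _ _ _ _ _ _ _ (dF x)).
      exact/cvg_at_right_filter/cF.
    exact/cvg_at_left_filter/cF.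
  - by move=> x _; rewrite derive1E (@derive_val _ _ _ _ _ _ _ (dF x)).
by rewrite /Rintegral F01.
Qed.

Lemma sin_natpi n : sin (n%:R * pi) = 0 :> R.
Proof.
by have := alternatingn (@sinDpi R) n 0; rewrite add0r sin0 mulr0 mulr_natl.
Qed.

(** At frequency 0 the quotient formula would collapse to 0; this is the diagonal case of the
    orthogonality relations. *)
Definition cos_primitive (c x : R) := if c == 0 then x else c^-1 * sin (c * x).

Lemma is_derive_cos_primitive c (x : R) :
  is_derive x 1 (cos_primitive c) (cos (c * x)).
Proof.
rewrite /cos_primitive; case: eqVneq => [->|c0].
  by rewrite mul0r cos0; exact: is_derive_id.
have dl : is_derive x 1 (c \*: (@id R)) (c *: 1) := is_deriveZ c (is_derive_id x 1).
have ds := is_derive1_comp (is_derive_sin ((c \*: (@id R)) x)) dl.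
apply: is_derive_eq (is_deriveZ c^-1 ds) _.
by rewrite -![_ *: _]/(_ * _) mulr1 mulrCA mulVf // mulr1.
Qed.

Lemma Rintegral_sin_sin m n : (0 < m)%N -> (0 < n)%N ->
  \int[mu]_x ((Num.sqrt 2 * sin (m%:R * pi * x)) *
              (Num.sqrt 2 * sin (n%:R * pi * x))) = (m == n)%:R.
Proof.
move=> m0 n0.
(* Product-to-sum gives cosines whose frequencies are integer multiples of pi, so the primitive
   vanishes at both ends unless [c = 0]. *)
pose c := (m%:R - n%:R) * pi : R; pose s := (m%:R + n%:R) * pi : R.
transitivity (\int[mu]_x (cos (c * x) - cos (s * x))).
  apply: eq_Rintegral => x _; rewrite mulrACA -expr2 sqr_sqrtr ?ler0n //.
  by rewrite /c /s !mulrDl !mulNr cosB cosD; ring.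
have dF (x : R) : is_derive x 1 (cos_primitive c - cos_primitive s)
    (cos (c * x) - cos (s * x)).
  by apply: is_deriveB; exact: is_derive_cos_primitive.
rewrite (Rintegral_mu01 _ dF).
- rewrite /cos_primitive; have s0 : s != 0.
    by rewrite mulf_neq0 ?gt_eqF ?pi_gt0 // ltr_wpDr ?ler0n // ltr0n.
  rewrite !fctE (negbTE s0) !mulr1 !mulr0 sin0 /s mulrDl sinD !sin_natpi.
  rewrite mulf_eq0 [pi == 0]gt_eqF ?pi_gt0 // orbF subr_eq0 eqr_nat.
  by case: eqP => _; rewrite /c ?mulrBl ?sinB ?sin_natpi !(mul0r, mulr0, addr0, subr0).
- move=> x; apply: continuousB.
    exact: (continuous_comp (@mulrl_continuous _ c x) (@continuous_cos _ _)).
  exact: (continuous_comp (@mulrl_continuous _ s x) (@continuous_cos _ _)).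
Qed.

Lemma Hfun_e m : {ae mu, forall x, Hfun (e_ R m) x = e_fun m x}.
Proof. exact: Hfun_pi (MkL2fun (e_fun_L2 R m)). Qed.

Lemma rip_e m n : (0 < m)%N -> (0 < n)%N -> rip (e_ R m) (e_ R n) = (m == n)%:R.
Proof.
move=> m0 n0; rewrite -(Rintegral_sin_sin m0 n0) /rip.
have L k := e_fun_L2 R k.
rewrite (rdot_ae (Hfun_L2 _) (L m) (Hfun_L2 _) (Hfun_e m)) rdotC.
rewrite (rdot_ae (Hfun_L2 _) (L n) (L m) (Hfun_e n)) rdotC.
by apply: eq_Rintegral => x _ /=; rewrite mulr0 addr0.
Qed.

(** One function is real-valued and the other purely imaginary, so this holds even for [m = n]. *)
Lemma rip_ei m n : rip (e_ R m) ('i *: e_ R n) = 0.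
Proof.
have L k := e_fun_L2 R k.
have Li : (fun x => 'i * e_fun n x) \in @L2pred R.
  exact: (valP ('i *: MkL2fun (L n))).
rewrite /rip.
rewrite (rdot_ae (Hfun_L2 _) (L m) (Hfun_L2 _) (Hfun_e m)) rdotC.
have h : {ae mu, forall x, Hfun ('i *: e_ R n) x = 'i * e_fun n x}.
  by apply: (@aeS2 _ _ _ mu _ _ _ _ (HfunZ 'i (e_ R n)) (Hfun_e n)) => x /= -> ->.
rewrite (rdot_ae (Hfun_L2 _) Li (L m) h).
transitivity (\int[mu]_(x in setT) (0 : R)); last by rewrite /Rintegral integral0.
by apply: eq_Rintegral => x _ /=; ring.
Qed.

Definition coef v m : R[i] := pairing (Hfun v) (Hfun (e_ R m)).

(* As [e_ m] is real-valued, the complex coefficient collects the real inner products with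
   [e_ m] and ['i *: e_ m]. *)
Lemma coefE v m : coef v m = Complex (rip v (e_ R m)) (rip v ('i *: e_ R m)).
Proof.
have hae := Hfun_e m.
have iv := Hfun_L2 v; have ie := Hfun_L2 (e_ R m).
rewrite /coef /pairing /cintegral; congr Complex.
  apply: ae_eq_Rintegral; last 1 first.
  - apply: (@aeS _ _ _ mu _ _ _ hae) => x /= ->.
    by case: (Hfun v x) => p q; rewrite /=; ring.
  - have := integrableB measurableT (L2_mul_integrable (L2_Re iv) (L2_Re ie))
      (L2_mul_integrable (L2_Im iv) (L2_Im ie)).
    apply: eq_integrable => // x _ /=; rewrite -EFinB.
    by case: (Hfun v x) (Hfun (e_ R m) x) => p q [p' q'].
  - exact: rdot_integrable.
rewrite ripC ripZE rdotC; apply: ae_eq_Rintegral; last 1 first.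
- apply: (@aeS _ _ _ mu _ _ _ hae) => x /= ->.
  by case: (Hfun v x) => p q /=; ring.
- have := integrableD measurableT (L2_mul_integrable (L2_Re iv) (L2_Im ie))
    (L2_mul_integrable (L2_Im iv) (L2_Re ie)).
  apply: eq_integrable => // x _ /=; rewrite -EFinD.
  by case: (Hfun v x) (Hfun (e_ R m) x) => p q [p1 q1].
- exact: rdot_integrable iv (L2predZ _ _).
Qed.

Lemma coefD v w m : coef (v + w) m = coef v m + coef w m.
Proof. by rewrite !coefE !ripDl. Qed.

Lemma coefN v m : coef (- v) m = - coef v m.
Proof. by rewrite !coefE !ripNl. Qed.

Lemma coefZe a m n : (0 < m)%N -> (0 < n)%N ->
  coef (a *: e_ R m) n = if m == n then a else 0.
Proof.
move=> m0 n0; rewrite coefE !(ripZl a) rip_ei rip_ii rip_e //.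
rewrite [rip ('i *: _) _]ripC rip_ei !mulr0 addr0 add0r.
by case: a => p q; case: eqP => _; rewrite /= ?mulr1 ?mulr0.
Qed.

Definition series_e (s : nat -> R[i]) M : H R := \sum_(1 <= m < M.+1) s m *: e_ R m.

Lemma coef_series (s : nat -> R[i]) M n : (0 < n <= M)%N -> coef (series_e s M) n = s n.
Proof.
case/andP=> n0; rewrite /series_e => nM.
have c0 : coef 0 n = 0 by rewrite coefE !rip0l.
rewrite (big_morph (coef^~ n) (fun v w => coefD v w n) c0).
rewrite (bigD1_seq n) ?mem_index_iota ?n0 ?iota_uniq //=.
rewrite coefZe // eqxx big1_seq ?addr0 // => m.
  case/andP=> mn; rewrite mem_index_iota => /andP[m0 _].
by rewrite coefZe // (negbTE mn).
Qed.

Lemma rip_series v (s : nat -> R[i]) M : rip v (series_e s M) =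
  \sum_(1 <= m < M.+1) (Re (s m) * Re (coef v m) + Im (s m) * Im (coef v m)).
Proof.
rewrite /series_e (big_morph (rip v) (fun u w => ripDr u w v) (id1 := 0)); last first.
  by rewrite ripC rip0l.
by apply: eq_bigr => m _; rewrite ripZr coefE.
Qed.

Lemma rip_series_series (s : nat -> R[i]) M : rip (series_e s M) (series_e s M) =
  \sum_(1 <= m < M.+1) Normc.normc (s m) ^+ 2.
Proof.
rewrite rip_series; apply: eq_big_nat => m mM; rewrite coef_series //.
by case: (s m) => p q /=; rewrite sqr_sqrtr ?addr_ge0 ?sqr_ge0 // -!expr2.
Qed.

(** Expand $0\le\|v-p\|^2$ with $p$ the partial sum of the expansion of $v$: both [rip v p] and
    [rip p p] equal the sum on the left. *)
Lemma bessel v M : \sum_(1 <= m < M.+1) Normc.normc (coef v m) ^+ 2 <= rip v v.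
Proof.
have E : rip v (series_e (coef v) M) = \sum_(1 <= m < M.+1) Normc.normc (coef v m) ^+ 2.
  rewrite rip_series; apply: eq_bigr => m _.
  by case: (coef v m) => p q /=; rewrite sqr_sqrtr ?addr_ge0 ?sqr_ge0 // -!expr2.
have := rip_ge0 (v - series_e (coef v) M).
rewrite ripDl !ripDr !ripNl !ripNr [rip (series_e _ _) v]ripC E rip_series_series; lra.
Qed.

End SineBasis.

(** * Limits in [H] *)

Section Convergence.
Variable R : realType.
Implicit Types (v w x y z : H R) (p q : nat -> H R).
Local Notation Re := complex.Re.
Local Notation Im := complex.Im.

Lemma hnorm_distr v w : `|hnorm v - hnorm w| <= hnorm (v - w).
Proof.
have h1 := hnormD (v - w) w; have h2 := hnormD (w - v) v.
rewrite subrK in h1; rewrite subrK -opprB hnormN in h2.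
rewrite ler_norml; lra.
Qed.

Lemma hcvg_squeeze p x (s : nat -> R) l c : hcvg p x ->
  (forall M, `|s M - l| <= c * hnorm (p M - x)) -> s @ \oo --> l.
Proof.
move=> px sl; apply/cvgrPdist_le => e e0.
(* The sign of [c] is unknown, so $|c|+1$ serves as a positive bound for it. *)
have c1 : 0 < `|c| + 1 by rewrite ltr_wpDl.
have ec : 0 < e / (`|c| + 1) by rewrite divr_gt0.
move/cvgrPdist_le: px => /(_ _ ec); apply: filterS => M.
rewrite sub0r normrN ger0_norm ?hnorm_ge0 // ler_pdivlMr // => h.
rewrite distrC (le_trans (sl M)) // (le_trans _ h) // mulrC ler_wpM2l ?hnorm_ge0 //.
by rewrite (le_trans (ler_norm _)) // lerDl.
Qed.

Lemma hcvg_hnorm p x : hcvg p x -> (hnorm (p M)) @[M --> \oo] --> hnorm x.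
Proof.
by move=> px; apply: (hcvg_squeeze (c := 1) px) => M; rewrite mul1r hnorm_distr.
Qed.

Lemma hcvg_rip p x z : hcvg p x -> (rip (p M) z) @[M --> \oo] --> rip x z.
Proof.
move=> px; apply: (hcvg_squeeze (c := hnorm z) px) => M; rewrite -ripNl -ripDl ler_norml.
have h1 := rip_le (p M - x) z; have h2 := rip_le (- (p M - x)) z.
rewrite hnormN ripNl in h2; rewrite mulrC; apply/andP; split; lra.
Qed.

Lemma hcvgB p q x y : hcvg p x -> hcvg q y ->
  hcvg (fun M => p M - q M) (x - y).
Proof.
move=> px qy; apply/cvgrPdist_le => e e0.
have e2 : 0 < e / 2 by rewrite divr_gt0.
move/cvgrPdist_le: px => /(_ _ e2) px; move/cvgrPdist_le: qy => /(_ _ e2) qy.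
apply: filterS2 px qy => M; rewrite !sub0r !normrN !ger0_norm ?hnorm_ge0 // => h1 h2.
rewrite (_ : _ - _ - _ = (p M - x) + - (q M - y)); last first.
  by rewrite !opprD !opprK addrACA addrC.
have := hnormD (p M - x) (- (q M - y)); rewrite hnormN; lra.
Qed.

Lemma hcvg_unique p x y : hcvg p x -> hcvg p y -> x = y.
Proof.
move=> px py; apply/eqP; rewrite -subr_eq0; apply/eqP/hnorm_eq0.
have := hcvg_hnorm (hcvgB px py); under eq_fun do rewrite subrr hnorm0.
by move=> /cvg_lim <- //; rewrite lim_cst.
Qed.

(** Coefficients are continuous along [hcvg], and here they are constant from index [n] on. *)
Lemma hcvg_coef p x n c : hcvg p x ->
  (forall M, (n <= M)%N -> coef (p M) n = c) -> coef x n = c.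
Proof.
move=> px pc.
have E z : (forall M, (n <= M)%N -> rip (p M) z = rip (p n) z) -> rip x z = rip (p n) z.
  move=> hz; have := @hcvg_rip _ _ z px.
  move/(@cvg_unique _ (@Rhausdorff R)); apply.
  apply: cvg_near_cst; near=> M; apply: hz; near: M; exact: nbhs_infty_ge.
rewrite -(pc n) // !coefE !E // => M nM.
  by have := pc M nM; rewrite -(pc n) // !coefE => -[_ ->].
by have := pc M nM; rewrite -(pc n) // !coefE => -[-> _].
Unshelve. all: by end_near. Qed.

End Convergence.

(** * The semigroup *)

Section Semigroup.
Variables (R : realType) (alpha : R) (S : R -> H R -> H R).
Hypothesis hS : is_exp_semigroup alpha S.
Local Notation Re := complex.Re.
Local Notation Im := complex.Im.

Lemma cexpD (z w : R[i]) : cexp (z + w) = cexp z * cexp w.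
Proof.
case: z w => a b [c d]; rewrite /cexp /= expRD cosD sinD.
by apply/eqP; rewrite eq_complex /=; apply/andP; split; apply/eqP; ring.
Qed.

Lemma normc_cexp (z : R[i]) : Normc.normc (cexp z) = expR (Re z).
Proof.
rewrite /cexp Normc.normcM /= cos2Dsin2 sqrtr1 mulr1 expr0n addr0 sqrtr_sqr.
by rewrite ger0_norm // expR_ge0.
Qed.

(** The eigenvalue of [S t] on [e_ m], that is $e^{-\alpha t-\mathbf{i}(m\pi)^2t}$. *)
Definition mode (t : R) (m : nat) : R[i] := cexp (- t%:C%C * Lambda_eig alpha m).

Lemma modeD s t m : mode (s + t) m = mode s m * mode t m.
Proof.
rewrite /mode -cexpD; congr cexp.
by apply/eqP; rewrite eq_complex /=; apply/andP; split; apply/eqP; ring.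
Qed.

(** The Laplacian contributes only a phase; the modulus is the damping, the same for all modes. *)
Lemma normc_mode t m : Normc.normc (mode t m) = expR (- (alpha * t)).
Proof. by rewrite normc_cexp /=; congr expR; ring. Qed.

Lemma S_cvg t v : 0 <= t -> hcvg (series_e (fun m => mode t m * coef v m)) (S t v).
Proof. exact: hS. Qed.

Lemma S_coef t v n : 0 <= t -> (0 < n)%N -> coef (S t v) n = mode t n * coef v n.
Proof.
by move=> t0 n0; apply: (hcvg_coef (S_cvg v t0)) => M nM; rewrite coef_series // n0.
Qed.

Lemma series_eB (s r : nat -> R[i]) M :
  series_e s M - series_e r M = series_e (fun m => s m - r m) M.
Proof. by rewrite /series_e -sumrB; apply: eq_bigr => m _; rewrite scalerBl. Qed.

(** [S] is known only as a limit of partial sums, so additivity comes from that of the coefficients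
    and from uniqueness of limits. *)
Lemma S_sub t v w : 0 <= t -> S t (v - w) = S t v - S t w.
Proof.
move=> t0; apply: hcvg_unique (S_cvg _ t0) _.
have := hcvgB (S_cvg v t0) (S_cvg w t0).
rewrite (_ : (fun _ => _) = series_e (fun m => mode t m * coef (v - w) m)) //.
apply/funext => M; rewrite series_eB /series_e; apply: eq_bigr => m _.
by rewrite coefD coefN mulrBr.
Qed.

(** Both sides have the same partial sums, because the modes multiply. *)
Lemma S_comp s t v : 0 <= s -> 0 <= t -> S s (S t v) = S (s + t) v.
Proof.
move=> s0 t0; apply: hcvg_unique (S_cvg _ s0) _.
have := S_cvg v (addr_ge0 s0 t0).
rewrite (_ : series_e _ = series_e (fun m => mode s m * coef (S t v) m)) //.
apply/funext => M; rewrite /series_e; apply: eq_big_nat => m /andP[m0 _].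
by rewrite S_coef // modeD mulrA.
Qed.

(** Bessel bounds every partial sum, all modes having the same modulus, and the bound passes to the
    limit. *)
Lemma S_contr t v : 0 <= t -> hnorm (S t v) <= expR (- (alpha * t)) * hnorm v.
Proof.
move=> t0; have /cvg_lim <- // := hcvg_hnorm (S_cvg v t0).
apply: limr_le; first by apply/cvg_ex; exists (hnorm (S t v)); exact/hcvg_hnorm/S_cvg.
apply: nearW => M.
rewrite -(@ler_pXn2r _ 2) ?nnegrE ?mulr_ge0 ?expR_ge0 ?hnorm_ge0 //.
rewrite exprMn !hnorm_sqr rip_series_series.
rewrite (eq_bigr (fun m => expR (- (alpha * t)) ^+ 2 * Normc.normc (coef v m) ^+ 2)).
  by rewrite -mulr_sumr ler_wpM2l ?sqr_ge0 // bessel.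
by move=> m _; rewrite Normc.normcM normc_mode exprMn.
Qed.

(** Stated for [j.+1], since zero iterations would amount to [S 0 v = v], the completeness of the
    sine system. *)
Lemma iter_S t v j : 0 <= t -> iter j.+1 (S t) v = S (j.+1%:R * t) v.
Proof.
move=> t0; elim: j => [|j IH]; first by rewrite mul1r.
rewrite iterS IH S_comp // ?mulr_ge0 ?ler0n //; congr (S _ _).
by rewrite [in RHS]mulrSr; ring.
Qed.

End Semigroup.

(** * The pathwise error recursion *)

Section PararealStep.
Variables (R : realType) (alpha : R) (S : R -> H R -> H R).
Hypothesis hS : is_exp_semigroup alpha S.
Variables (LF : R) (F : H R -> H R).
Hypothesis LF0 : 0 <= LF.
Hypothesis hF : forall v w, hnorm (F v - F w) <= LF * hnorm (v - w).
Implicit Types (x y z : H R).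

(** The propagator at a fixed sample point, with the noise increment as a parameter [z]. *)
Definition euler_step h z x : H R :=
  S h x + (Complex 0 h : R[i]) *: S h (F x) + S h z.

Lemma euler_step_sub h z x y : 0 <= h ->
  euler_step h z x - euler_step h z y =
  S h (x - y) + (Complex 0 h : R[i]) *: S h (F x - F y).
Proof.
move=> h0; rewrite /euler_step opprD addrACA subrr addr0 opprD addrACA.
by rewrite !(S_sub hS) // scalerBr.
Qed.

Lemma hnorm_nonlinear h x y : 0 <= h ->
  hnorm ((Complex 0 h : R[i]) *: S h (F x - F y)) <=
  expR (- (alpha * h)) * (LF * h) * hnorm (x - y).
Proof.
move=> h0; rewrite hnormZ /= expr0n add0r sqrtr_sqr ger0_norm //.
have h1 := S_contr hS (F x - F y) h0.
have h2 := ler_wpM2l (expR_ge0 (- (alpha * h))) (hF x y).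
have := ler_wpM2l h0 (le_trans h1 h2); lra.
Qed.

Lemma euler_step_lip h z x y : 0 <= h ->
  hnorm (euler_step h z x - euler_step h z y) <=
  expR (- (alpha * h)) * (1 + LF * h) * hnorm (x - y).
Proof.
move=> h0; rewrite euler_step_sub // (le_trans (hnormD _ _)) //.
have h1 := S_contr hS (x - y) h0; have h2 := hnorm_nonlinear x y h0; lra.
Qed.

(** The bounds are proved together: the deviation from the linear flow is transported by [S h] and
    gains one Lipschitz term per step, whose size the first bound controls. *)
Lemma fine_steps h (z x y : nat -> H R) J : 0 <= h ->
  (forall j, (j < J)%N -> x j.+1 = euler_step h (z j) (x j)) ->
  (forall j, (j < J)%N -> y j.+1 = euler_step h (z j) (y j)) ->
  let rho := expR (- (alpha * h)) * (1 + LF * h) in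
  forall j, (j <= J)%N ->
  hnorm (x j - y j) <= rho ^+ j * hnorm (x 0%N - y 0%N) /\
  hnorm (x j - y j - iter j (S h) (x 0%N - y 0%N)) <=
    (j%:R * h * LF) * rho ^+ j * hnorm (x 0%N - y 0%N).
Proof.
move=> h0 hx hy rho; set d := hnorm (x 0%N - y 0%N).
have q0 := expR_ge0 (- (alpha * h)).
have Lh : 0 <= LF * h by rewrite mulr_ge0.
have rho0 : 0 <= rho by rewrite mulr_ge0 // addr_ge0.
have d0 : 0 <= d by exact: hnorm_ge0.
have lip w a b : hnorm (euler_step h w a - euler_step h w b) <= rho * hnorm (a - b).
  exact: euler_step_lip.
have qrho : expR (- (alpha * h)) <= rho by rewrite ler_peMr // lerDl.
clearbody rho.
elim=> [|j IH] jJ.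
  by rewrite expr0 mul1r !mul0r /= subrr hnorm0; split.
have [IH1 IH2] := IH (ltnW jJ).
rewrite hx // hy //; split.
  rewrite (le_trans (lip _ _ _)) // exprS -[leRHS]mulrA.
  exact: ler_wpM2l.
rewrite euler_step_sub // iterS addrAC -(S_sub hS) //.
apply: (le_trans (hnormD _ _)).
have h1 := S_contr hS (x j - y j - iter j (S h) (x 0%N - y 0%N)) h0.
have h2 := hnorm_nonlinear (x j) (y j) h0.
have h3 := ler_wpM2l q0 IH2.
have h4 := ler_wpM2l (mulr_ge0 q0 Lh) IH1.
(* Both terms carry the damping factor of the new step; it is at most [rho] and completes the power
   [rho ^+ j.+1]. *)
apply: (@le_trans _ _ (j.+1%:R * h * LF * (expR (- (alpha * h)) * rho ^+ j * d))).
  rewrite -natr1; lra.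
rewrite exprS -!mulrA; do 3 apply: ler_wpM2l => //.
by apply: ler_wpM2r => //; rewrite mulr_ge0 // exprn_ge0.
Qed.

(** The damping is computed exactly; only the growth is estimated, by $1+L_Fh\le e^{L_Fh}$. *)
Lemma rho_pow_le h J T : 0 <= h -> J%:R * h <= T ->
  (expR (- (alpha * h)) * (1 + LF * h)) ^+ J <=
  expR (- (alpha * (J%:R * h))) * expR (LF * T).
Proof.
move=> h0 kT; rewrite exprMn -expRM_natl; apply: ler_pM.
- exact: expR_ge0.
- by rewrite exprn_ge0 // addr_ge0 // mulr_ge0.
- by rewrite mulrN mulrCA.
apply: (@le_trans _ _ (expR (LF * h) ^+ J)).
  by rewrite lerXn2r ?nnegrE ?expR_ge0 ?addr_ge0 ?mulr_ge0 // expR_ge1Dx.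
by rewrite -expRM_natl ler_expR mulrCA ler_wpM2l.
Qed.

(* Over one coarse interval the noise cancels, and so does [S dT] against [S dt] iterated [J]
   times: only the Lipschitz terms, of size [dT], are left in the correction. *)
Lemma parareal_step h J zc (z x y : nat -> H R) (u1 u1' : H R) T :
  0 <= h -> (0 < J)%N -> J%:R * h <= T ->
  (forall j, (j < J)%N -> x j.+1 = euler_step h (z j) (x j)) ->
  (forall j, (j < J)%N -> y j.+1 = euler_step h (z j) (y j)) ->
  let k := J%:R * h in
  u1' = euler_step k zc u1 + x J - euler_step k zc (x 0%N) ->
  hnorm (u1' - y J) <=
    expR (- (alpha * k)) * (1 + LF * k) * hnorm (u1 - y 0%N) +
    expR (- (alpha * k)) * (k * (LF * (expR (LF * T) + 1))) *
      hnorm (x 0%N - y 0%N).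
Proof.
move=> h0 J0 kT hx hy k ->; have k0 : 0 <= k by rewrite mulr_ge0.
have [_] := fine_steps h0 hx hy (leqnn J).
(* The [J] fine linear flows compose to the coarse one; [prednK] exhibits the successor that
   [iter_S] expects. *)
rewrite -[J in iter J]prednK // (iter_S hS) // prednK // -/k.
set d := hnorm (x 0%N - y 0%N).
set Z := (X in hnorm X <= _) => hZ.
(* Insert the coarse step from [y 0]. The remainder compares $x_J-y_J$ with the difference of the
   coarse steps from $x_0$ and $y_0$; subtracting $S(k)(x_0-y_0)$ from both leaves [Z] and the
   coarse Lipschitz term. *)
have -> : euler_step k zc u1 + x J - euler_step k zc (x 0%N) - y J =
    (euler_step k zc u1 - euler_step k zc (y 0%N)) +
    (Z - (Complex 0 k : R[i]) *: S k (F (x 0%N) - F (y 0%N))).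
  have tele (V : zmodType) (a b c e f s : V) :
      a + b - c - f = (a - e) + (b - f - s - (c - e - s)).
    rewrite (opprB (c - e)) [b - f - s + _]addrA subrK opprB.
    rewrite [b - f + _]addrC addrA [a - e + _]addrA.
    by rewrite subrK addrACA addrA.
  have := euler_step_sub zc (x 0%N) (y 0%N) k0.
  set E0 := euler_step k zc (x 0%N); set E1 := euler_step k zc (y 0%N).
  set E2 := euler_step k zc u1; set s := S k (_ - _).
  set t := _ *: S k _ => Et.
  by have -> : t = E0 - E1 - s; [rewrite Et addrAC subrr add0r|exact: tele].
have h1 := euler_step_lip zc u1 (y 0%N) k0.
have h2 := hnorm_nonlinear (x 0%N) (y 0%N) k0; rewrite -/d in h2.
(* In the final constant, [expR (LF * T)] comes from this fine deviation and the summand 1 from the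
   coarse Lipschitz term [h2]. *)
have h3 : k * LF * (expR (- (alpha * h)) * (1 + LF * h)) ^+ J * d <=
    k * LF * (expR (- (alpha * k)) * expR (LF * T)) * d.
  rewrite ler_wpM2r ?hnorm_ge0 // ler_wpM2l ?mulr_ge0 //; exact: rho_pow_le.
apply: (le_trans (hnormD _ _)); apply: (le_trans (lerD h1 (hnormD _ _))).
rewrite hnormN; have := le_trans hZ h3; lra.
Qed.

End PararealStep.

(** * Errors in L2(Omega; H) *)

Section Probability.
Context (R : realType) (d : measure_display) (Omega : measurableType d).
Variable P : probability Omega R.
Implicit Types (f g h : Omega -> R) (X Y : Omega -> H R).

(** The pair takes finitely many values, so each preimage is a finite union of measurable
    rectangles. *)
Lemma measurable_hnorm_simple X Y :
  H_simple measurable X -> H_simple measurable Y ->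
  measurable_fun setT (fun w => hnorm (X w - Y w)).
Proof.
move=> [fX mX] [fY mY] _ B mB; rewrite setTI.
have -> : (fun w => hnorm (X w - Y w)) @^-1` B =
  \bigcup_(a in range X) \bigcup_(b in range Y `&` [set b | B (hnorm (a - b))])
    (X @^-1` [set a] `&` Y @^-1` [set b]).
  apply/seteqP; split => w /=.
    by move=> Bw; exists (X w); [exists w|exists (Y w) => //; split=> //; exists w].
  by move=> [a _ [b [_ Bab] [-> ->]]].
apply: fin_bigcup_measurable => // a _.
apply: fin_bigcup_measurable; first exact: finite_setIl.
by move=> b _; exact: measurableI.
Qed.

Lemma measurable_hnorm_sub X Y : H_random_variable X -> H_random_variable Y ->
  measurable_fun setT (fun w => hnorm (X w - Y w)).
Proof.
move=> [Xn [sX cX]] [Yn [sY cY]].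
apply: (measurable_fun_cvg (h := fun n w => hnorm (Xn n w - Yn n w))).
  by move=> n; exact: measurable_hnorm_simple.
by move=> w _; apply: hcvg_hnorm; exact: hcvgB.
Qed.

Local Notation N2 f := ('N[P]_2%:E[EFin \o f])%E.

Let mpow f : measurable_fun setT f ->
  measurable_fun setT (fun w => `|(f w)%:E| `^ 2)%E.
Proof.
move=> mf; apply/measurable_EFinP.
apply: (@measurableT_comp _ _ _ _ _ _ (@powR R ^~ 2)).
  exact: measurable_powR.
exact: measurableT_comp.
Qed.

Lemma le_ae_L2norm f g : measurable_fun setT f -> measurable_fun setT g ->
  (forall w, 0 <= f w) -> {ae P, forall w, f w <= g w} -> (N2 f <= N2 g)%E.
Proof.
move=> mf mg f0 fg; rewrite unlock.
rewrite gt0_ler_poweR // ?in_itv /= ?leey ?andbT;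
  try by apply: integral_ge0 => w _; rewrite lee_fin powR_ge0.
apply: ae_ge0_le_integral.
- exact: measurableT.
- by move=> w _; rewrite lee_fin powR_ge0.
- exact: mpow.
- by move=> w _; rewrite lee_fin powR_ge0.
- exact: mpow.
apply: (@aeS _ _ _ P _ _ _ fg) => w /= fgw _.
rewrite lee_fin ge0_ler_powR ?nnegrE // !ger0_norm //; exact: le_trans fgw.
Qed.

Lemma L2normZ (a : R) f : measurable_fun setT f -> 0 <= a ->
  N2 (fun w => (a * f w)%R) = (a%:E * N2 f)%E.
Proof.
move=> mf a0; rewrite unlock.
transitivity ((\int[P]_w ((a `^ 2)%:E * (`|(f w)%:E| `^ 2))) `^ 2^-1)%E.
  congr (_ `^ _)%E; apply: eq_integral => w _ /=.
  by rewrite normrM powRM // ger0_norm // EFinM.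
rewrite ge0_integralZl_EFin ?powR_ge0 //; last 2 first.
- by move=> w _; exact: poweR_ge0.
- exact: mpow.
rewrite poweRM ?lee_fin ?powR_ge0 ?integral_ge0 //.
  by rewrite poweR_EFin -powRrM mulfV // powRr1.
by move=> w _; exact: poweR_ge0.
Qed.

(** Minkowski carries the pathwise recursion over to $L^2(\Omega)$ norms, which are extended reals
    and may be infinite. *)
Lemma L2norm_le_lincomb (a b : R) f g h :
  measurable_fun setT f -> measurable_fun setT g -> measurable_fun setT h ->
  (forall w, 0 <= f w) -> 0 <= a -> 0 <= b ->
  {ae P, forall w, f w <= a * g w + b * h w} ->
  (N2 f <= a%:E * N2 g + b%:E * N2 h)%E.
Proof.
move=> mf mg mh f0 a0 b0 fgh.
have mag : measurable_fun setT (fun w => a * g w) by exact: measurable_funM.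
have mbh : measurable_fun setT (fun w => b * h w) by exact: measurable_funM.
rewrite -!L2normZ //; apply: le_trans (minkowski_EFin P mag mbh _); last by rewrite ler1n.
by apply: le_ae_L2norm => //; exact: measurable_funD.
Qed.

End Probability.

(** * The double recursion in iteration and time index *)

Section Recursion.
Variable R : realType.

(** The left side is a falling factorial, a product of [k] factors that are at most [n]. *)
Lemma bin_le_exp n k : ('C(n, k) * k`! <= n ^ k)%N.
Proof.
rewrite bin_ffact; elim: k n => [|k IH] [|n] //.
rewrite ffactSS expnS leq_mul2l /= (leq_trans (IH _)) //.
by case: k {IH} => // k; rewrite leq_exp2r.
Qed.

(** The binomial counts the ways to place [k] correction steps of weight [b] among [n] time steps;
    the weights of the others are absorbed in [A ^+ n], as [A] dominates both [a] and 1. *)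
Lemma double_recursion (N : nat) (a b A : R) (M : \bar R) (e : nat -> nat -> \bar R) :
  0 <= a -> 0 <= b -> a <= A -> 1 <= A -> (0 <= M)%E ->
  (forall n, (n <= N)%N -> e 0%N n <= M)%E ->
  (forall k, e k.+1 0%N <= 0)%E ->
  (forall k n, (n < N)%N -> e k.+1 n.+1 <= a%:E * e k.+1 n + b%:E * e k n)%E ->
  forall k n, (n <= N)%N -> (e k n <= (b ^+ k * 'C(n, k)%:R * A ^+ n)%:E * M)%E.
Proof.
move=> a0 b0 aA A1 M0 e0 ek0 rec; have A0 : 0 <= A by exact: le_trans A1.
elim=> [|k IHk]; elim=> [|n IHn] nN.
- by rewrite expr0 bin0 !mul1r expr0 mul1e e0.
- rewrite (le_trans (e0 _ nN)) // expr0 bin0 !mul1r -[leLHS]mul1e.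
  by rewrite lee_wpmul2r // lee_fin exprn_ege1.
- by rewrite (le_trans (ek0 k)) // bin0n mulr0 mul0r mul0e.
have c0 i j : 0 <= b ^+ i * 'C(n, j)%:R * A ^+ n :> R by rewrite !mulr_ge0 ?exprn_ge0.
apply: (le_trans (rec _ _ nN)).
apply: (@le_trans _ _ (a%:E * ((b ^+ k.+1 * 'C(n, k.+1)%:R * A ^+ n)%:E * M) +
   b%:E * ((b ^+ k * 'C(n, k)%:R * A ^+ n)%:E * M))%E).
  by apply: leeD; rewrite lee_wpmul2l ?lee_fin // ?IHn ?IHk // ltnW.
(* [M] may be infinite, so distributivity rests on nonnegative coefficients. *)
rewrite !muleA -!EFinM -ge0_muleDl; try by rewrite lee_fin mulr_ge0.
rewrite -EFinD.
rewrite lee_wpmul2r // lee_fin binS natrD.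
(* Each term of Pascal's rule receives one more factor [A]: the first from [a <= A], the second from
   [1 <= A]. *)
have h1 : a * (b ^+ k.+1 * 'C(n, k.+1)%:R * A ^+ n) <=
    A * (b ^+ k.+1 * 'C(n, k.+1)%:R * A ^+ n) by rewrite ler_wpM2r.
have h2 : 1 * (b ^+ k.+1 * 'C(n, k)%:R * A ^+ n) <=
    A * (b ^+ k.+1 * 'C(n, k)%:R * A ^+ n) by rewrite ler_wpM2r.
move: h1 h2; rewrite !exprS; lra.
Qed.

(** The factor $N^{-k}$ of the step size cancels $\binom nk\le N^k/k!$, and at most $N$ factors of
    the maximum restore the full time [T] in the exponent. *)
Lemma recursion_constant_le (E C T c : R) (N k n : nat) : (0 < N)%N -> (n <= N)%N ->
  0 <= E -> 0 <= C -> 0 <= T ->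
  (E * (T / N%:R * C)) ^+ k * 'C(n, k)%:R * Num.max (expR (c * (T / N%:R))) 1 ^+ n <=
  E ^+ k * ((C * T) ^+ k / k`!%:R) * Num.max (expR (c * T)) 1.
Proof.
move=> N0 nN E0 C0 T0; set A := Num.max _ 1.
have N0' : 0 < N%:R :> R by rewrite ltr0n.
have A1 : 1 <= A by rewrite le_max lexx orbT.
apply: ler_pM.
- by rewrite mulr_ge0 // exprn_ge0 // !mulr_ge0 // invr_ge0.
- by rewrite exprn_ge0 // (le_trans ler01).
- rewrite (_ : E * (T / N%:R * C) = E * (C * T) / N%:R); last by ring.
  rewrite expr_div_n exprMn -!mulrA ler_wpM2l ?exprn_ge0 //.
  rewrite ler_wpM2l ?exprn_ge0 ?mulr_ge0 // mulrC ler_pdivrMr ?exprn_gt0 // mulrC.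
  rewrite ler_pdivlMr ?ltr0n ?fact_gt0 // -natrM -natrX ler_nat.
  by apply: leq_trans (bin_le_exp n k) _; case: (k) => // j; rewrite leq_exp2r.
apply: (@le_trans _ _ (A ^+ N)); first exact: ler_weXn2l.
rewrite le_max /A; have [_|_] := ltP (expR _) 1; first by rewrite expr1n lexx orbT.
by rewrite -expRM_natl mulrCA [N%:R * _]mulrC divfK ?gt_eqF // lexx.
Qed.

End Recursion.

(** * From almost sure identities to the convergence estimate *)

Lemma ae_forall_lt d (Omega : measurableType d) (R : realType)
    (m : {measure set Omega -> \bar R}) (J : nat) (A : nat -> Omega -> Prop) :
  (forall j, (j < J)%N -> {ae m, forall w, A j w}) ->
  {ae m, forall w, forall j, (j < J)%N -> A j w}.
Proof.
move=> hA; apply: ae_foralln => j; have [jJ|Jj] := ltnP j J.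
  by apply: (aeS _ (hA j jJ)) => w Aw _.
by apply: aeW.
Qed.

(** After taking logarithms: $\ln t^{-1}\le\ln s^{-1}=\alpha s\le\alpha t$. *)
Lemma expR_le_step (R : realType) (alpha t s : R) :
  0 < s -> s <= t -> t < 1 -> s^-1 * ln s^-1 = alpha -> 0 < alpha ->
  expR (- alpha * t) <= t.
Proof.
move=> s0 st t1 sa a0; have t0 : 0 < t by exact: lt_le_trans st.
rewrite -[leRHS]lnK ?posrE // ler_expR mulNr lerNl -lnV ?posrE //.
apply: (@le_trans _ _ (ln s^-1)).
  by rewrite ler_ln ?posrE ?invr_gt0 // lef_pV2 ?posrE.
have -> : ln s^-1 = alpha * s by rewrite -sa mulrAC mulVf ?gt_eqF // mul1r.
by rewrite ler_wpM2l // ltW.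
Qed.

Theorem theorem4p2 (R : realType) (LF T : R) (hLF : 0 < LF) (hT : 0 < T) :
  exists C : R, 0 < C /\
  forall (alpha : R) (halpha : 0 <= alpha)
    (S : R -> H R -> H R) (hS : is_exp_semigroup alpha S)
    (F : H R -> H R)
    (hFlip : forall v w, hnorm (F v - F w) <= LF * hnorm (v - w))
    (hF0 : F 0 = 0)
    (hFim : forall v, complex.Im (pairing (hconj v) (Hfun (F v))) = 0)
    (Q Qhalf : {linear H R -> H R})
    (hQ : nonneg_symmetric Q) (hQhalf : nonneg_symmetric Qhalf)
    (hQsq : forall v, Qhalf (Qhalf v) = Q v)
    (hQbd : bounded_op Qhalf)
    (d : measure_display) (Omega : measurableType d) (P : probability Omega R)
    (Filt : R -> set (set Omega)) (hFilt : complete_filtered_space P Filt)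
    (sigma : R) (hsigma : 0 < sigma)
    (beta : nat -> R -> Omega -> R[i])
    (hbeta : wiener_coordinates P Filt sigma beta)
    (QW : R -> Omega -> H R) (hQW : is_noise P Qhalf beta QW)
    (u0 : Omega -> H R) (hu0 : H_measurable_wrt (Filt 0) u0)
    (N J : nat) (hN : (1 <= N)%N) (hJ : (1 <= J)%N),
  let dT : R := T / N%:R in
  let dt : R := dT / J%:R in
  let Tn (n : nat) : R := n%:R * dT in
  let tnj (n j : nat) : R := Tn n + j%:R * dt in
  let GI := propagator S F QW dT in
  let FI := propagator S F QW dt in
  forall
    (* the parareal scheme: u k n is u_n^(k), uhat k n j is \hat u_(n,j)^(k) *)
    (u : nat -> nat -> Omega -> H R)
    (uhat : nat -> nat -> nat -> Omega -> H R)
    (hu_rv : forall k n, (n <= N)%N -> H_random_variable (u k n))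
    (huhat_rv : forall k n j, (n < N)%N -> (j <= J)%N ->
       H_random_variable (uhat k n j))
    (hu_init : forall k, {ae P, forall w, u k 0%N w = u0 w})
    (hu_coarse : forall n, (n < N)%N ->
       {ae P, forall w, u 0%N n.+1 w = GI (Tn n.+1) (Tn n) (u 0%N n) w})
    (huhat_init : forall k n, (n < N)%N ->
       {ae P, forall w, uhat k n 0%N w = u k n w})
    (huhat_step : forall k n j, (n < N)%N -> (j < J)%N ->
       {ae P, forall w,
         uhat k n j.+1 w = FI (tnj n j.+1) (tnj n j) (uhat k n j) w})
    (hu_correct : forall k n, (n < N)%N ->
       {ae P, forall w,
         u k.+1 n.+1 w = GI (Tn n.+1) (Tn n) (u k.+1 n) w
                         + uhat k n J w - GI (Tn n.+1) (Tn n) (u k n) w})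
    (v : nat -> nat -> Omega -> H R)
    (hv_rv : forall n j, (n < N)%N -> (j <= J)%N -> H_random_variable (v n j))
    (hv_rvN : H_random_variable (v N 0%N))
    (hv_init : {ae P, forall w, v 0%N 0%N w = u0 w})
    (hv_step : forall n j, (n < N)%N -> (j < J)%N ->
       {ae P, forall w, v n j.+1 w = FI (tnj n j.+1) (tnj n j) (v n j) w})
    (hv_next : forall n, (n < N)%N -> {ae P, forall w, v n.+1 0%N w = v n J w}),
  let err (k : nat) : \bar R :=
    ereal_sup [set L2_Omega_H_norm P (fun w => u k n w - v n 0%N w)
              | n in [set n : nat | (n <= N)%N]] in
  (forall k : nat,
     (err k <= (expR (- alpha * dT) ^+ k * ((C * T) ^+ k / k`!%:R)
                * Num.max (expR ((LF - alpha) * T)) 1)%:E * err 0%N)%E)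
  /\
  (forall dTstar : R,
     0 < alpha -> 0 < dTstar -> dTstar < 1 ->
     dTstar^-1 * ln dTstar^-1 = alpha ->
     dTstar <= dT -> dT < 1 ->
     forall k : nat,
       (err k <= (dT ^+ k * ((C * T) ^+ k / k`!%:R)
                  * Num.max (expR ((LF - alpha) * T)) 1)%:E * err 0%N)%E).
Proof.
(* The constant of [parareal_step], depending only on [LF] and [T]. *)
exists (LF * (expR (LF * T) + 1)); split.
  by rewrite mulr_gt0 // addr_gt0 ?expR_gt0.
set C := LF * _ => alpha al0 S hS F hF _ _ _ Qhalf _ _ _ _ d Omega P Filt _ sigma _
  beta _ QW _ u0 _ N J N0 J0 dT dt Tn tnj GI FI u uhat hu _ hu0 _ huh0 huhS huS
  v hv hvN hv0 hvS hvn err.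
have N0' : 0 < N%:R :> R by rewrite ltr0n.
have dT0 : 0 <= dT by rewrite divr_ge0 // ltW.
have dt0 : 0 <= dt by rewrite divr_ge0.
have Jdt : J%:R * dt = dT by rewrite mulrC divfK // pnatr_eq0 -lt0n.
have dTT : dT <= T by rewrite ler_pdivrMr // ler_peMr ?ler1n // ltW.
have LF0 : 0 <= LF by exact: ltW.
have C0 : 0 <= C by rewrite mulr_ge0 // addr_ge0 ?expR_ge0.
(* The node [n = N] starts no interval, so it is covered by [hvN] separately. *)
have hvr n : (n <= N)%N -> H_random_variable (v n 0%N).
  by rewrite leq_eqVlt => /predU1P[->|nN] //; exact: hv.
have me k n : (n <= N)%N -> measurable_fun setT (fun w => hnorm (u k n w - v n 0%N w)).
  by move=> nN; apply: measurable_hnorm_sub; [exact: hu|exact: hvr].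
pose e k n := L2_Omega_H_norm P (fun w => u k n w - v n 0%N w).
have e_err k n : (n <= N)%N -> (e k n <= err k)%E.
  by move=> nN; apply: ereal_sup_ubound; exists n.
have err0 k : (0 <= err k)%E.
  by apply: le_trans (e_err k 0%N (leq0n N)); exact: Lnorm_ge0.
pose a := expR (- alpha * dT) * (1 + LF * dT).
pose b := expR (- alpha * dT) * (dT * C).
pose A := Num.max (expR ((LF - alpha) * dT)) 1.
have a0 : 0 <= a by rewrite mulr_ge0 ?expR_ge0 // addr_ge0 // mulr_ge0.
have b0 : 0 <= b by rewrite mulr_ge0 ?expR_ge0 // mulr_ge0.
have aA : a <= A.
  rewrite le_max; apply/orP; left.
  rewrite (_ : (LF - alpha) * dT = - alpha * dT + LF * dT); last by ring.
  by rewrite expRD ler_wpM2l ?expR_ge0 // expR_ge1Dx.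
have e00 k : (e k.+1 0%N <= 0)%E.
  (* With both coefficients 0, the bound says that an almost surely zero error has norm at most
     0. *)
  have := @L2norm_le_lincomb _ _ _ P 0 0 _ _ _ (me k.+1 0%N (leq0n N))
    (me k.+1 0%N (leq0n N)) (me k.+1 0%N (leq0n N)).
  rewrite !mul0e adde0; apply => //; first by move=> w; exact: hnorm_ge0.
  apply: (aeS2 _ (hu0 k.+1) hv0) => w -> ->.
  by rewrite subrr hnorm0 !mul0r addr0.
have rec k n : (n < N)%N ->
    (e k.+1 n.+1 <= a%:E * e k.+1 n + b%:E * e k n)%E.
  move=> nN; apply: L2norm_le_lincomb => //; try by apply: me => //; exact: ltnW.
    by move=> w; exact: hnorm_ge0.
  have h1 := ae_forall_lt (fun j => huhS k n j nN).
  have h2 := ae_forall_lt (fun j => hvS n j nN).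
  (* All identities of one coarse interval are gathered outside a single null set, where the
     pathwise estimate applies. *)
  apply: (aeS2 _ (aeS2 (fun w => @conj _ _) (huS k n nN) (hvn n nN))
    (aeS2 (fun w => @conj _ _) (huh0 k n nN) (aeS2 (fun w => @conj _ _) h1 h2))).
  move=> w [hc ->] [hi [hx hy]].
  have := parareal_step (zc := QW (Tn n.+1) w - QW (Tn n) w)
    (z := fun j => QW (tnj n j.+1) w - QW (tnj n j) w)
    (x := fun j => uhat k n j w) (y := fun j => v n j w)
    (u1 := u k.+1 n w) (u1' := u k.+1 n.+1 w) hS LF0 hF dt0 J0 (T := T).
  rewrite Jdt hi /a /b !mulNr; apply => //.
have A1 : 1 <= A by rewrite le_max lexx orbT.
have main k : (err k <= (expR (- alpha * dT) ^+ k * ((C * T) ^+ k / k`!%:R)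
    * Num.max (expR ((LF - alpha) * T)) 1)%:E * err 0%N)%E.
  apply: ge_ereal_sup => _ [n /= nN <-].
  apply: (le_trans (double_recursion a0 b0 aA A1 (err0 0%N) (e_err 0%N) e00 rec k nN)).
  apply: lee_wpmul2r => //; rewrite lee_fin.
  by apply: recursion_constant_le; rewrite ?expR_ge0 // ltW.
split=> // s al s0 s1 sa sT T1 k; apply: (le_trans (main k)).
apply: lee_wpmul2r => //; rewrite lee_fin.
apply: ler_wpM2r; first by rewrite le_max ler01 orbT.
apply: ler_wpM2r.
  by rewrite divr_ge0 // exprn_ge0 // mulr_ge0 // ltW.
(* On the stated range of steps the damping $e^{-\alpha\delta T}$ is at most $\delta T$, so its
   [k]-th power yields order [k]. *)
rewrite lerXn2r ?nnegrE ?expR_ge0 //; exact: expR_le_step sT T1 sa al.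
Qed.
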